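(* Let $\{\mathcal{U}_1,\ldots,\mathcal{U}_r\}$ and $\{\mathcal{V}_1,\ldots,\mathcal{V}_r\}$ be two orthonormal subsets of $\mathbb{C}^{I_1\times\cdots\times I_N}$ (each consisting of $r$ tensors). If $\mathcal{A}=\mathcal{U}_1\mathcal{V}_1^H+\mathcal{U}_2\mathcal{V}_2^H+\cdots+\mathcal{U}_r\mathcal{V}_r^H\in\mathbb{C}^{I_1\times\cdots\times I_N\times I_1\times\cdots\times I_N}$, then $\mathcal{A}^\dagger=\mathcal{V}_1\mathcal{U}_1^H+\mathcal{V}_2\mathcal{U}_2^H+\cdots+\mathcal{V}_r\mathcal{U}_r^H$, and $W(\mathcal{A}^\dagger)=W(\mathcal{A}^H)$.
   Context: For $\mathcal{U},\mathcal{V}\in\mathbb{C}^{I_1\times\cdots\times I_N}$, $\mathcal{U}\mathcal{V}^H\in\mathbb{C}^{I_1\times\cdots\times I_N\times I_1\times\cdots\times I_N}$ denotes the outer product with entries $(\mathcal{U}\mathcal{V}^H)_{i_1\ldots i_Nj_1\ldots j_N}=u_{i_1\ldots i_N}\overline{v_{j_1\ldots j_N}}$. $\langle\mathcal{X},\mathcal{Y}\rangle=\sum_{i_1,\ldots,i_N}x_{i_1\ldots i_N}\overline{y_{i_1\ldots i_N}}$ and $\|\mathcal{X}\|=\langle\mathcal{X},\mathcal{X}\rangle^{1/2}$; a set $\{\mathcal{U}_1,\ldots,\mathcal{U}_r\}$ is orthonormal if $\langle\mathcal{U}_i,\mathcal{U}_j\rangle=0$ for $i\ne j$ and $\langle\mathcal{U}_i,\mathcal{U}_i\rangle=1$.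 For tensors $\mathcal{A},\mathcal{B}\in\mathbb{C}^{I_1\times\cdots\times I_N\times I_1\times\cdots\times I_N}$ the Einstein product is $(\mathcal{A}*_N\mathcal{B})_{i_1\ldots i_Nj_1\ldots j_N}=\sum_{k_1,\ldots,k_N}a_{i_1\ldots i_Nk_1\ldots k_N}b_{k_1\ldots k_Nj_1\ldots j_N}$, and $(\mathcal{A}*_N\mathcal{X})_{i_1\ldots i_N}=\sum_{k_1,\ldots,k_N}a_{i_1\ldots i_Nk_1\ldots k_N}x_{k_1\ldots k_N}$ for $\mathcal{X}\in\mathbb{C}^{I_1\times\cdots\times I_N}$. The conjugate transpose is $(\mathcal{A}^H)_{i_1\ldots i_Nj_1\ldots j_N}=\overline{a_{j_1\ldots j_Ni_1\ldots i_N}}$. The Moore--Penrose inverse $\mathcal{A}^\dagger$ of $\mathcal{A}$ is the unique tensor $\mathcal{X}$ of the same size satisfying $\mathcal{A}*_N\mathcal{X}*_N\mathcal{A}=\mathcal{A}$, $\mathcal{X}*_N\mathcal{A}*_N\mathcal{X}=\mathcal{X}$, $(\mathcal{A}*_N\mathcal{X})^H=\mathcal{A}*_N\mathcal{X}$, $(\mathcal{X}*_N\mathcal{A})^H=\mathcal{X}*_N\mathcal{A}$. The numerical range is $W(\mathcal{A})=\{\langle\mathcal{A}*_N\mathcal{X},\mathcal{X}\rangle:\mathcal{X}\in\mathbb{C}^{I_1\times\cdots\times I_N},\|\mathcal{X}\|=1\}$. *)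

(* Defs.v *)
From mathcomp Require Import all_boot all_order all_algebra.
From mathcomp Require Import boolp classical_sets.

Set Implicit Arguments.
Unset Strict Implicit.
Unset Printing Implicit Defensive.

Import Order.TTheory GRing.Theory Num.Theory.
Local Open Scope ring_scope.

Section Tensors.
Variables (C : numClosedFieldType) (N : nat) (I : 'I_N -> nat).

(* Multi-indices (i_1, ..., i_N) with i_k < I_k. *)
Definition mindex : finType := {dffun forall k : 'I_N, 'I_(I k)}.

Definition tensor : Type := {ffun mindex -> C}.

(* C^(I_1 x ... x I_N x I_1 x ... x I_N): the 2N indices are grouped as a pair
   of multi-indices. *)
Definition sqtensor : Type := {ffun mindex * mindex -> C}.

Definition outerH (U V : tensor) : sqtensor :=
  [ffun ij : mindex * mindex => U ij.1 * (V ij.2)^*].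

Definition tinner (X Y : tensor) : C := \sum_i X i * (Y i)^*.

Definition tnorm (X : tensor) : C := sqrtC (tinner X X).

Definition torthonormal (r : nat) (U : 'I_r -> tensor) : Prop :=
  (forall i j : 'I_r, i != j -> tinner (U i) (U j) = 0) /\
  (forall i : 'I_r, tinner (U i) (U i) = 1).

Definition einstein_mul (A B : sqtensor) : sqtensor :=
  [ffun ij : mindex * mindex => \sum_k A (ij.1, k) * B (k, ij.2)].

Definition einstein_app (A : sqtensor) (X : tensor) : tensor :=
  [ffun i => \sum_k A (i, k) * X k].

Definition adjoint (A : sqtensor) : sqtensor :=
  [ffun ij : mindex * mindex => (A (ij.2, ij.1))^*].

Definition is_mpinv (A X : sqtensor) : Prop :=
  [/\ einstein_mul (einstein_mul A X) A = A,
      einstein_mul (einstein_mul X A) X = X,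
      adjoint (einstein_mul A X) = einstein_mul A X &
      adjoint (einstein_mul X A) = einstein_mul X A].

(* The predicate is_mpinv A is satisfied by exactly one tensor for every A, so
   the fallback value 0 of xget is never used. *)
Definition mpinv (A : sqtensor) : sqtensor :=
  xget 0 [set X : sqtensor | is_mpinv A X]%classic.

Definition numrange (A : sqtensor) : set C :=
  [set z | exists2 X : tensor, tnorm X = 1 & z = tinner (einstein_app A X) X]%classic.

End Tensors.

(* Main.v *)
(* By orthonormality A A^H = sum U_k U_k^H and A^H A = sum V_k V_k^H are the
   orthogonal projections on the spans of the U_k and of the V_k, so A^H
   satisfies the four Penrose equations.  Hence A^dagger = A^H, and the equality
   of the numerical ranges is immediate. *)
Require Import Defs.
From mathcomp Require Import all_boot all_order all_algebra.
From mathcomp Require Import boolp classical_sets reals complex.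

Set Implicit Arguments.
Unset Strict Implicit.
Unset Printing Implicit Defensive.

Import GRing.Theory Num.Theory.
Local Open Scope ring_scope.

Section EinsteinProduct.
Variables (C : numClosedFieldType) (N : nat) (I : 'I_N -> nat).
Implicit Types (A B X Y : sqtensor C I) (U V W : tensor C I).

Lemma einstein_mulA A B X :
  einstein_mul A (einstein_mul B X) = einstein_mul (einstein_mul A B) X.
Proof.
apply/ffunP => -[i j]; rewrite !ffunE /=.
under eq_bigr => k _ do rewrite ffunE mulr_sumr /=.
rewrite exchange_big; apply: eq_bigr => k _.
by rewrite ffunE mulr_suml; apply: eq_bigr => l _; rewrite mulrA.
Qed.

Lemma adjoint_mul A B :
  adjoint (einstein_mul A B) = einstein_mul (adjoint B) (adjoint A).
Proof.
apply/ffunP => -[i j]; rewrite !ffunE /= rmorph_sum.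
by apply: eq_bigr => k _; rewrite !ffunE rmorphM mulrC.
Qed.

Lemma mpinv_uniq A X Y : is_mpinv A X -> is_mpinv A Y -> X = Y.
Proof.
move=> [AXA XAX AXh XAh] [AYA YAY AYh YAh].
(* AX = (AY)(AX); taking adjoints, AX = (AX)(AY) = AY.  Likewise XA = YA. *)
have AXY : einstein_mul A X = einstein_mul A Y.
  by rewrite -AXh -{1}AYA -einstein_mulA adjoint_mul AXh AYh einstein_mulA AXA.
have XAY : einstein_mul X A = einstein_mul Y A.
  rewrite -XAh -{1}AYA -einstein_mulA einstein_mulA adjoint_mul XAh YAh.
  by rewrite -einstein_mulA [einstein_mul A (einstein_mul X A)]einstein_mulA AXA.
by rewrite -XAX XAY -einstein_mulA AXY einstein_mulA YAY.
Qed.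

(** Since [mpinv] is a choice made by [xget], uniqueness reduces its computation to exhibiting one
    solution of the Penrose equations. *)
Lemma mpinvE A X : is_mpinv A X -> mpinv A = X.
Proof. by move=> AX; apply: xget_unique => // Y /mpinv_uniq; apply. Qed.

Lemma adjoint_sum_outerH r (U V : 'I_r -> tensor C I) :
  adjoint (\sum_k outerH (U k) (V k)) = \sum_k outerH (V k) (U k).
Proof.
apply/ffunP => -[i j]; rewrite ffunE !sum_ffunE rmorph_sum.
by apply: eq_bigr => k _; rewrite !ffunE rmorphM /= conjCK mulrC.
Qed.

(** Each product of [outerH (U k) (V k)] with [outerH (V l) (W l)] is [outerH (U k) (W l)] scaled by
    [tinner (V l) (V k)], so only the terms with [l = k] survive. The third family [W] lets the same
    rule cover every product in the Penrose equations. *)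
Lemma mul_sum_outerH r (U V W : 'I_r -> tensor C I) : torthonormal V ->
  einstein_mul (\sum_k outerH (U k) (V k)) (\sum_k outerH (V k) (W k))
  = \sum_k outerH (U k) (W k).
Proof.
move=> [V0 V1]; apply/ffunP => -[i j]; rewrite ffunE sum_ffunE /=.
(* Summing over the contracted multi-index first turns the two middle factors into an inner
   product. *)
transitivity (\sum_k \sum_l U k i * (W l j)^* * tinner (V l) (V k)).
  under eq_bigr => m _ do rewrite !sum_ffunE mulr_suml.
  rewrite exchange_big; apply: eq_bigr => k _.
  under eq_bigr => m _ do rewrite mulr_sumr.
  rewrite exchange_big; apply: eq_bigr => l _.
  rewrite mulr_sumr; apply: eq_bigr => m _.
  by rewrite !ffunE /= [X in _ * X = _]mulrC mulrACA [X in _ * X = _]mulrC.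
apply: eq_bigr => k _; rewrite (bigD1 k) //= V1 mulr1 big1 ?addr0 ?ffunE //.
by move=> l lk; rewrite V0 // mulr0.
Qed.

Lemma mpinv_sum_outerH r (U V : 'I_r -> tensor C I) :
  torthonormal U -> torthonormal V ->
  mpinv (\sum_k outerH (U k) (V k)) = \sum_k outerH (V k) (U k).
Proof.
move=> oU oV; apply: mpinvE.
(* The triple products contract twice, once through [oV] and once through [oU]; the last two
   equations reduce to the self-adjointness of the sums of [outerH (U k) (U k)] and of
   [outerH (V k) (V k)]. *)
by split; rewrite !mul_sum_outerH ?adjoint_sum_outerH.
Qed.

End EinsteinProduct.

Theorem theorem5p8 (R : realType) (N : nat) (I : 'I_N -> nat) (r : nat)
    (U V : 'I_r -> tensor R[i] I) (A : sqtensor R[i] I)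
    (hU : torthonormal U) (hV : torthonormal V)
    (hA : A = \sum_(k < r) outerH (U k) (V k)) :
  mpinv A = \sum_(k < r) outerH (V k) (U k) /\
  numrange (mpinv A) = numrange (adjoint A).
Proof. by rewrite hA adjoint_sum_outerH mpinv_sum_outerH. Qed.
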